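(* Let $\Gamma$ be the H-graph (vertices $1,\dots,6$, edges $12,13,14,25,26$) with weights $(w_1,\dots,w_6)=(1,3,2,3,-1,-1)$, for which $M(\Gamma)$ is the Poincaré homology sphere. Then its indefinite false theta function $\widehat{Z}_\Gamma(q)$ has the form $$\widehat{Z}_\Gamma(q)=q^{-3/2}\sum_{n=-1}^{\infty}\chi_{60}(n)\,q^{(n^2-1)/120},$$ where $\chi_{60}(n)=e_1e_2e_3$ if $\frac{n}{30}\equiv1-\frac{e_1}{2}-\frac{e_2}{3}-\frac{e_3}{5}\pmod{2\mathbb{Z}}$ for some $e_1,e_2,e_3\in\{\pm1\}$, and $\chi_{60}(n)=0$ otherwise. Moreover, this $q$-series coincides with the homological block of the Poincaré homology sphere.
   Context: Notation: $\mathbf{e}(z)=e^{2\pi i z}$; $\mathrm{sgn}(x)=1$ for $x\ge0$ and $-1$ for $x<0$; $q$ is a complex variable with $|q|<1$. $M(\Gamma)$ is the plumbed 3-manifold obtained from $S^3$ by surgery along the framed link of unknots associated with $\Gamma$ (framings the weights, unknots simply linked along edges). The graph $\Gamma$ above is obtained by Neumann moves from the star-shaped graph with central weight $1$ and leaves of weights $2,3,5$, which gives the Poincaré homology sphere. Indefinite false theta function of an H-graph with weights $w_1,\dots,w_6$. Let $$W=\begin{pmatrix}w_1&1&1&1&0&0\\1&w_2&0&0&1&1\\1&0&w_3&0&0&0\\1&0&0&w_4&0&0\\0&1&0&0&w_5&0\\0&1&0&0&0&w_6\end{pmatrix},$$ with $\det W=\pm1$, let $S$ be the upper-left $2\times2$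 submatrix of $-W^{-1}$ (assumed indefinite), $\sigma_W,\sigma_S$ the signatures of $W,S$ (number of positive minus number of negative eigenvalues), $M=w_3w_4$, $N=w_5w_6$, $a=-w_2w_5w_6+w_5+w_6$, $c=-w_1w_3w_4+w_3+w_4$, $Q'(x,y)=|Ma|x^2+2|MN|xy+|Nc|y^2$, $\sigma'_W=-\sigma_W-\sigma_S+\mathrm{sgn}(w_3)+\mathrm{sgn}(w_4)+\mathrm{sgn}(w_5)+\mathrm{sgn}(w_6)$. Let $\mathcal{T}=\{\tfrac12+\tfrac{e_3}{2w_3}+\tfrac{e_4}{2w_4}: e_3,e_4\in\{\pm1\}\}$, $\mathcal{U}=\{\tfrac12+\tfrac{e_5}{2w_5}+\tfrac{e_6}{2w_6}: e_5,e_6\in\{\pm1\}\}$, $\chi(\alpha)=\sum e_3e_4$ over all $(e_3,e_4)\in\{\pm1\}^2$ with $\alpha=\tfrac12+\tfrac{e_3}{2w_3}+\tfrac{e_4}{2w_4}$, and $\psi(\beta)=\sum e_5e_6$ over all $(e_5,e_6)\in\{\pm1\}^2$ with $\beta=\tfrac12+\tfrac{e_5}{2w_5}+\tfrac{e_6}{2w_6}$. Then $$\widehat{Z}_\Gamma(q)=q^{\left(3\sigma_W-\sum_{i=1}^6w_i-\sum_{i=3}^6 1/w_i\right)/4}\,\mathbf{e}(\sigma'_W/8)\,\mathrm{sgn}(Na)\sum_{\alpha\in\mathcal{T}}\sum_{\beta\in\mathcal{U}}\chi(\alpha)\psi(\beta)\sum_{m,n\ge0}q^{Q'(\alpha+m,\beta+n)}.$$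 Homological block of the Poincaré homology sphere (defined by Gukov--Pei--Putrov--Vafa; given by the formula of Gukov--Manolescu for weakly negative definite plumbing graphs). For the star-shaped graph above the linking matrix is $$B=\begin{pmatrix}1&1&1&1\\1&2&0&0\\1&0&3&0\\1&0&0&5\end{pmatrix}$$ and the homological block is $$(-1)^{\pi_B}q^{(3\sigma_B-\mathrm{tr}B)/4}\sum_{\ell\in(1,1,1,1)+2\mathbb{Z}^4}F_{\ell_0}F_{\ell_1}F_{\ell_2}F_{\ell_3}\,q^{-{}^t\ell B^{-1}\ell/4},$$ where $\ell=(\ell_0,\ell_1,\ell_2,\ell_3)$, $\pi_B$ is the number of positive eigenvalues of $B$, $\sigma_B$ its signature, $F_{\ell_0}=\tfrac12\mathrm{sgn}(\ell_0)$, and for $1\le i\le3$, $F_{\ell_i}=-\ell_i$ if $\ell_i\in\{\pm1\}$ and $F_{\ell_i}=0$ otherwise.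
   Formalization: As stated the claim fails: the n=1 term (χ60(1)=-1) cancels the n=-1 term, and the given formula for Ẑ_Γ starts with -q^{-3/2}. Proved instead: the sum runs over n≥-1 with n≠1, it equals the homological block, and Ẑ_Γ equals minus this series. *)

(* Defs.v *)
From HB Require Import structures.
From mathcomp Require Import all_boot all_order all_algebra.
From mathcomp Require Import all_classical all_reals all_analysis.
From mathcomp Require Import complex polyrcf.

Set Implicit Arguments.
Unset Strict Implicit.
Unset Printing Implicit Defensive.

Import Order.TTheory GRing.Theory Num.Theory.

Local Open Scope classical_set_scope.
Local Open Scope ring_scope.
Local Open Scope complex_scope.

Section Analysis.
Variable R : realType.

(* e(z) = exp (2 pi i z) *)
Definition ee (z : R[i]) : R[i] :=
  (expR (- (2 * pi * complex.Im z)))%:C *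
  (cos (2 * pi * complex.Re z) +i* sin (2 * pi * complex.Re z)).

(* Fractional powers of q are fixed by the choice of tau with q = ee tau. *)
Definition qpow (tau : R[i]) (r : rat) : R[i] := ee ((ratr r)%:C * tau).

(* Sums of absolutely convergent families, from the library's sums of
   nonnegative extended reals: positive minus negative part, componentwise. *)
Definition rsum (I : choiceType) (D : set I) (f : I -> R) : R :=
  fine (\esum_(i in D) (Num.max (f i) 0)%:E) -
  fine (\esum_(i in D) (Num.max (- f i) 0)%:E).

Definition csum (I : choiceType) (D : set I) (f : I -> R[i]) : R[i] :=
  rsum D (fun i => complex.Re (f i)) +i* rsum D (fun i => complex.Im (f i)).

Definition csummable (I : choiceType) (D : set I) (f : I -> R[i]) : Prop :=
  summable D (fun i => (Normc.normc (f i))%:E).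

(* Eigenvalues are counted with their multiplicity in the characteristic
   polynomial; these functions are meant for real symmetric matrices. *)
Definition num_pos_eigen n (A : 'M[R]_n) : nat :=
  \sum_(x <- rootsR (char_poly A) | 0 < x) mup x (char_poly A).

Definition num_neg_eigen n (A : 'M[R]_n) : nat :=
  \sum_(x <- rootsR (char_poly A) | x < 0) mup x (char_poly A).

Definition signature n (A : 'M[R]_n) : int :=
  (num_pos_eigen A)%:Z - (num_neg_eigen A)%:Z.

Definition indefinite n (A : 'M[R]_n) : Prop :=
  (0 < num_pos_eigen A)%N /\ (0 < num_neg_eigen A)%N.

End Analysis.

(* Unlike Num.sg, this takes the value 1 at 0. *)
Definition sgn (x : int) : int := if 0 <= x then 1 else -1.

Definition signs : seq int := [:: 1; -1].

(* Square matrix from the list of its rows; the entry (i, j) of the usual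
   1-based notation is the one with indices (i - 1, j - 1). *)
Definition mx_of_rows n (rows : seq (seq int)) : 'M[int]_n :=
  \matrix_(i, j) nth 0 (nth [::] rows i) j.

(* Weights of the graph with vertices 1, ..., 6 and edges 12, 13, 14, 25, 26. *)
Record hgraph := HGraph {
  w1 : int; w2 : int; w3 : int; w4 : int; w5 : int; w6 : int }.

Section HGraph.
Variable G : hgraph.

Definition Wmx : 'M[int]_6 := mx_of_rows 6
  [:: [:: w1 G; 1;    1;    1;    0;    0   ];
      [:: 1;    w2 G; 0;    0;    1;    1   ];
      [:: 1;    0;    w3 G; 0;    0;    0   ];
      [:: 1;    0;    0;    w4 G; 0;    0   ];
      [:: 0;    1;    0;    0;    w5 G; 0   ];
      [:: 0;    1;    0;    0;    0;    w6 G]].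

Definition WmxR (R : realType) : 'M[R]_6 := map_mx intr Wmx.

Definition Smx (R : realType) : 'M[R]_2 :=
  @ulsubmx R 2 4 2 4 (- invmx (WmxR R)).

Definition hM : int := w3 G * w4 G.
Definition hN : int := w5 G * w6 G.
Definition ha : int := - (w2 G * w5 G * w6 G) + w5 G + w6 G.
Definition hc : int := - (w1 G * w3 G * w4 G) + w3 G + w4 G.

Definition Qprime (x y : rat) : rat :=
  `|hM * ha|%:~R * x ^+ 2 + 2 * `|hM * hN|%:~R * x * y
  + `|hN * hc|%:~R * y ^+ 2.

Definition sigma_W (R : realType) : int := signature (WmxR R).
Definition sigma_S (R : realType) : int := signature (Smx R).

Definition sigma'_W (R : realType) : int :=
  - sigma_W R - sigma_S R + sgn (w3 G) + sgn (w4 G) + sgn (w5 G) + sgn (w6 G).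

Definition shift (u v e f : int) : rat :=
  2^-1 + e%:~R / (2 * u%:~R) + f%:~R / (2 * v%:~R).

(* The set of shifts, listed without repetition. *)
Definition shifts (u v : int) : seq rat :=
  undup [seq shift u v e f | e <- signs, f <- signs].

Definition shift_weight (u v : int) (x : rat) : int :=
  \sum_(e <- signs) \sum_(f <- signs | x == shift u v e f) e * f.

Definition hT : seq rat := shifts (w3 G) (w4 G).
Definition hU : seq rat := shifts (w5 G) (w6 G).
Definition hchi : rat -> int := shift_weight (w3 G) (w4 G).
Definition hpsi : rat -> int := shift_weight (w5 G) (w6 G).

Definition theta_term (R : realType) (tau : R[i]) (alpha beta : rat)
    (p : nat * nat) : R[i] :=
  qpow tau (Qprime (alpha + p.1%:R) (beta + p.2%:R)).

Definition Zhat_exponent (R : realType) : rat :=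
  ((3 * sigma_W R - (w1 G + w2 G + w3 G + w4 G + w5 G + w6 G))%:~R
   - ((w3 G)%:~R^-1 + (w4 G)%:~R^-1 + (w5 G)%:~R^-1 + (w6 G)%:~R^-1)) / 4.

Definition Zhat (R : realType) (tau : R[i]) : R[i] :=
  qpow tau (Zhat_exponent R) * ee ((sigma'_W R)%:~R / 8) *
  (sgn (hN * ha))%:~R *
  \sum_(alpha <- hT) \sum_(beta <- hU)
    (hchi alpha)%:~R * (hpsi beta)%:~R *
    csum [set: nat * nat] (theta_term tau alpha beta).

(* Standing assumptions under which the false theta function is defined. *)
Definition hgraph_admissible (R : realType) : Prop :=
  (\det Wmx = 1 \/ \det Wmx = -1) /\ indefinite (Smx R).

End HGraph.

Definition chi60_residue (e : int * int * int) (n : int) : bool :=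
  (n%:~R / 30 - (1 - e.1.1%:~R / 2 - e.1.2%:~R / 3 - e.2%:~R / 5)) / 2
    \is a @Num.int rat.

(* At most one sign triple satisfies the congruence for a given n, so taking
   the first one found involves no choice. *)
Definition chi60 (n : int) : int :=
  head 0 [seq e.1.1 * e.1.2 * e.2
         | e <- [seq (e12, e3) | e12 <- [seq (e1, e2) | e1 <- signs,
                                                        e2 <- signs],
                                 e3 <- signs]
         & chi60_residue e n].

Definition chi60_term (R : realType) (tau : R[i]) (n : int) : R[i] :=
  (chi60 n)%:~R * qpow tau ((n ^+ 2 - 1)%:~R / 120).

Definition Bmx : 'M[int]_4 := mx_of_rows 4
  [:: [:: 1; 1; 1; 1];
      [:: 1; 2; 0; 0];
      [:: 1; 0; 3; 0];
      [:: 1; 0; 0; 5]].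

Definition odd_vectors : set 'cV[int]_4 :=
  [set l | forall i, exists k : int, l i 0 = 1 + 2 * k].

Section HomologicalBlock.
Variable R : realType.

Definition BmxR : 'M[R]_4 := map_mx intr Bmx.

Definition Fcenter (l : int) : R[i] := (sgn l)%:~R / 2.
Definition Fleaf (l : int) : R[i] :=
  if (l == 1) || (l == -1) then - l%:~R else 0.

Definition Bform (l : 'cV[int]_4) : rat :=
  let v := map_mx intr l in
  (v^T *m invmx (map_mx intr Bmx : 'M[rat]_4) *m v) 0 0.

Definition block_term (tau : R[i]) (l : 'cV[int]_4) : R[i] :=
  Fcenter (l 0 0) * \prod_(i < 4 | i != 0) Fleaf (l i 0) *
  qpow tau (- Bform l / 4).

Definition homological_block (tau : R[i]) : R[i] :=
  (-1) ^+ num_pos_eigen BmxR *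
  qpow tau ((3 * signature BmxR - \tr Bmx)%:~R / 4) *
  csum odd_vectors (block_term tau).

End HomologicalBlock.

Definition GammaP : hgraph := HGraph 1 3 2 3 (-1) (-1).

(* Main.v *)
(* All three series are the sum over a in {1, -1}^3 of a_1 a_2 a_3 times the
   partial theta series sum_(m >= 0) q^(((60 m + r_a)^2 - 1) / 120), with
   r_a = 30 - 15 a_1 - 10 a_2 - 6 a_3.
   - The n >= -1, n <> 1 with chi_60(n) <> 0 are exactly the 60 m + r_a, each
     obtained once; the excluded n = 1 is 60 * (-1) + 61.
   - Here Q'(x, y) = 30 x^2 + 12 x y + y^2, and the shifts beta are -1/2, 1/2,
     1/2, 3/2 with signs +, -, -, +. The sum over n telescopes to the boundary
     terms y = -1/2 and y = 1/2, where Q' is a square plus a constant.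
   - In the homological block the leaves are forced to be 1 or -1, and completing
     the square in the central variable gives the same quadratic exponent; l and
     -l contribute equally, which cancels the factor 1/2.
   The remaining prefactors are read off the signatures of W, S and B, which come
   from sign changes of the characteristic polynomials. *)

Require Import Defs.
From HB Require Import structures.
From mathcomp Require Import all_boot all_order all_algebra.
From mathcomp Require Import all_classical all_reals all_analysis.
From mathcomp Require Import complex polyrcf.
From mathcomp Require Import ring lra zify.

Set Implicit Arguments.
Unset Strict Implicit.
Unset Printing Implicit Defensive.

Import Order.TTheory GRing.Theory Num.Theory.

Local Open Scope classical_set_scope.
Local Open Scope ring_scope.
Local Open Scope complex_scope.

(** * Signatures and inverses of the linking matrices *)

(** Cofactor expansion along the first row, on entry functions instead of matrices so that
    [vm_compute] can run it; zero entries prune the recursion. *)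
Fixpoint laplace_det (n : nat) (f : nat -> nat -> int) : int :=
  if n is n'.+1 then
    foldr +%R 0 [seq if f 0%N j == 0 then 0 else
      f 0%N j * ((-1) ^+ j * laplace_det n' (fun a b => f a.+1 (bump j b)))
      | j <- iota 0 n]
  else 1.

Lemma laplace_detE n (f : nat -> nat -> int) :
  \det (\matrix_(i < n, j < n) f i j) = laplace_det n f.
Proof.
elim: n f => [|n IHn] f; first by rewrite det_mx00.
rewrite (expand_det_row _ ord0) /laplace_det -/laplace_det foldrE big_map.
rewrite -[iota 0 n.+1]/(index_iota 0 n.+1) big_mkord.
apply: eq_bigr => j _; rewrite mxE; case: eqVneq => [->|_]; first by rewrite mul0r.
rewrite /cofactor -IHn; congr (_ * (_ * \det _)).
by apply/matrixP => a b; rewrite !mxE.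
Qed.

Section RealRoots.
Variable R : rcfType.
Implicit Types (p : {poly R}) (P : pred R) (a : R) (s : seq R).

(** The intermediate value theorem gives a root strictly inside each interval between consecutive
    sample points; these intervals are disjoint, so the roots come out distinct and sorted. *)
Lemma sign_changes_roots p a s :
    path (fun x y => (x < y) && (p.[x] * p.[y] < 0)) a s ->
  exists2 rs : seq R, size rs = size s &
    [/\ sorted <%R rs, all (root p) rs & all (fun x => a < x < last a s) rs].
Proof.
elim: s a => [|b s IHs] a /=; first by exists [::].
move=> /andP[/andP[ltab pab] /[dup] bs /IHs[rs szrs [srs rrs lrs]]].
have [c cab rc] := poly_ivtoo (ltW ltab) pab.
have lb : b <= last b s.
  have : path <=%R b s by apply: sub_path bs => x y /andP[/ltW].
  case/lastP: (s) => //= s' x.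
  by rewrite last_rcons (path_sortedE le_trans) all_rcons => /andP[/andP[]].
move: cab; rewrite in_itv /= => /andP[ac cb].
exists (c :: rs); first by rewrite /= szrs.
split=> /=.
- rewrite (path_sortedE lt_trans) srs andbT; apply/allP => x /(allP lrs)/andP[bx _].
  exact: lt_trans bx.
- by rewrite rc.
- rewrite ac (lt_le_trans cb lb); apply/allP => x /(allP lrs)/andP[bx ->].
  by rewrite andbT (lt_trans ltab bx).
Qed.

(** All multiplicities are 1 for a product of distinct linear factors, so counting with multiplicity
    is plain counting. *)
Lemma sum_mup_rootsR (P : pred R) s :
  uniq s -> let p := \prod_(x <- s) ('X - x%:P) in
  \sum_(x <- rootsR p | P x) mup x p = count P s.
Proof.
move=> us p.
have p0 : p != 0 by apply/monic_neq0/monic_prod_XsubC.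
have rp x : root p x = (x \in s) by exact: root_prod_XsubC.
have perm : perm_eq (rootsR p) s.
  apply: uniq_perm => // [|x]; first exact: uniq_roots.
  by rewrite -roots_on_rootsR // in_itv /= rp.
rewrite (perm_big s perm) /= -sum1_count big_seq_cond [RHS]big_seq_cond.
apply: eq_bigr => x /andP[xs _].
rewrite {}/p in p0 rp perm *; rewrite (big_rem x xs) /= mupMl.
  by have := mup_XsubCX 1 x x; rewrite expr1 eqxx.
by rewrite root_prod_XsubC mem_rem_uniq // !inE eqxx.
Qed.

End RealRoots.

Section Signature.
Variable R : realType.

(* The sign changes already account for all n roots, so these are simple. *)
Lemma eigenvalue_counts n (A : 'M[R]_n) (a : R) (s t : seq R) :
    let alternates := fun x y : R =>
      (x < y) && ((char_poly A).[x] * (char_poly A).[y] < 0) in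
    path alternates a s -> last a s = 0 -> path alternates 0 t ->
    (size s + size t)%N = n ->
  num_neg_eigen A = size s /\ num_pos_eigen A = size t.
Proof.
move=> alternates /sign_changes_roots[rs szs [srs ars lrs]] las.
move=> /sign_changes_roots[rt szt [srt art lrt]] szn.
rewrite las in lrs.
have us : uniq (rs ++ rt).
  apply: (sorted_uniq lt_trans ltxx); rewrite (sorted_pairwise lt_trans) pairwise_cat.
  rewrite -!(sorted_pairwise lt_trans) srs srt !andbT.
  apply/allrelP => x y /(allP lrs)/andP[_ x0] /(allP lrt)/andP[y0 _].
  exact: lt_trans y0.
have cpE : char_poly A = \prod_(x <- rs ++ rt) ('X - x%:P).
  rewrite [LHS](@all_roots_prod_XsubC _ _ (rs ++ rt)).
  - by rewrite (monicP (char_poly_monic A)) scale1r.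
  - by rewrite size_char_poly size_cat szs szt szn.
  - by rewrite all_cat ars art.
  - by rewrite uniq_rootsE.
have crs P (b : bool) : (forall x, x \in rs -> P x = b) -> count P rs = (b * size s)%N.
  move=> Pb; rewrite (@eq_in_count _ _ (fun=> b)) // -szs.
  by case: (b); rewrite ?count_predT ?count_pred0 ?mul1n.
have crt P (b : bool) : (forall x, x \in rt -> P x = b) -> count P rt = (b * size t)%N.
  move=> Pb; rewrite (@eq_in_count _ _ (fun=> b)) // -szt.
  by case: (b); rewrite ?count_predT ?count_pred0 ?mul1n.
rewrite /num_neg_eigen /num_pos_eigen cpE !sum_mup_rootsR // !count_cat; split.
- rewrite (crs _ true) => [|x /(allP lrs)/andP[] //].
  by rewrite (crt _ false) => [|x /(allP lrt)/andP[/lt_gtF] //]; rewrite mul1n addn0.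
- rewrite (crt _ true) => [|x /(allP lrt)/andP[] //].
  by rewrite (crs _ false) => [|x /(allP lrs)/andP[_ /lt_gtF] //]; rewrite mul1n.
Qed.

(* The integer det (k - 2 A), which is 2 ^ n times the characteristic polynomial
   at k / 2; integral points do not separate the eigenvalues of W, two of which
   lie in [-2, -1]. *)
Definition char_poly_at_half n (rows : seq (seq int)) (k : int) : int :=
  laplace_det n (fun i j => (if i == j then k else 0) - 2 * nth 0 (nth [::] rows i) j).

Lemma horner_char_poly_half n (rows : seq (seq int)) (k : int) :
  (char_poly (map_mx intr (mx_of_rows n rows) : 'M[R]_n)).[k%:~R / 2] =
  (char_poly_at_half n rows k)%:~R / 2 ^+ n.
Proof.
apply: (canRL (mulfK _)); first by rewrite expf_neq0 // pnatr_eq0.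
rewrite /char_poly -horner_evalE -det_map_mx mulrC -detZ.
rewrite /char_poly_at_half -laplace_detE -det_map_mx; congr (\det _).
apply/matrixP => i j; rewrite !mxE /= horner_evalE.
rewrite hornerD hornerN hornerMn hornerX hornerC.
rewrite mulrBr rmorphB rmorphM /=; congr (_ - _).
rewrite -val_eqE; case: eqP => _ /=; last by rewrite mulr0n mulr0.
by rewrite mulr1n mulrCA divff ?mulr1 // pnatr_eq0.
Qed.

(** All hypotheses form one boolean about integers, hence are decidable by computation. The first
    list of sample points must end at 0 and the second starts there, which separates negative from
    positive eigenvalues. *)
Lemma eigenvalue_counts_half n (rows : seq (seq int)) (k : int) (s t : seq int) :
    let alternates := fun x y : int =>
      (x < y) && (char_poly_at_half n rows x * char_poly_at_half n rows y < 0) in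
    path alternates k s && (last k s == 0) && path alternates 0 t
      && (size s + size t == n)%N ->
  let A := map_mx intr (mx_of_rows n rows) : 'M[R]_n in
  num_neg_eigen A = size s /\ num_pos_eigen A = size t.
Proof.
move=> alternates /andP[/andP[/andP[ps /eqP l0] pt] /eqP szn] A.
pose h (x : int) : R := x%:~R / 2.
have h0 : h 0 = 0 by rewrite /h mul0r.
have sub l x : path alternates x l -> path (fun x y : R =>
      (x < y) && ((char_poly A).[x] * (char_poly A).[y] < 0)) (h x) (map h l).
  rewrite path_map; apply: sub_path => {}x y /andP[xy pxy] /=.
  rewrite !horner_char_poly_half ltr_pM2r ?invr_gt0 // ltr_int xy /=.
  by rewrite mulrACA -intrM pmulr_llt0 ?ltrz0 // mulr_gt0 // invr_gt0 exprn_gt0.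
rewrite -(size_map h s) -(size_map h t); apply: (@eigenvalue_counts _ _ (h k)).
- exact: sub.
- by rewrite last_map l0.
- by have := sub _ _ pt; rewrite h0.
- by rewrite !size_map.
Qed.

Lemma W_eigenvalue_counts :
  num_neg_eigen (WmxR GammaP R) = 3%N /\ num_pos_eigen (WmxR GammaP R) = 3%N.
Proof.
(* In half units: the sign alternates along -2, -3/2, -1/2, 0 and along 0, 3, 4, 5. *)
apply: (@eigenvalue_counts_half 6 _ (-4) [:: -3; -1; 0] [:: 6; 8; 10]).
by vm_compute.
Qed.

Lemma B_eigenvalue_counts :
  num_neg_eigen (BmxR R) = 1%N /\ num_pos_eigen (BmxR R) = 3%N.
Proof.
apply: (@eigenvalue_counts_half 4 _ (-2) [:: 0] [:: 6; 8; 12]).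
by vm_compute.
Qed.

End Signature.

(** * Integer inverses of the linking matrices *)

Lemma mx_of_rows_mul n (rows1 rows2 rows3 : seq (seq int)) :
    all (fun i => all (fun j =>
        foldr +%R 0 [seq nth 0 (nth [::] rows1 i) k * nth 0 (nth [::] rows2 k) j
                    | k <- iota 0 n]
        == nth 0 (nth [::] rows3 i) j) (iota 0 n)) (iota 0 n) ->
  mx_of_rows n rows1 *m mx_of_rows n rows2 = mx_of_rows n rows3.
Proof.
move=> /allP eq3; apply/matrixP => i j; rewrite !mxE.
have /eq3/allP/(_ j) : (i : nat) \in iota 0 n by rewrite mem_iota add0n ltn_ord.
have -> : iota 0 n = index_iota 0 n by rewrite /index_iota subn0.
rewrite mem_index_iota foldrE big_map big_mkord => /(_ (ltn_ord j))/eqP <-.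
by apply: eq_bigr => k _; rewrite !mxE.
Qed.

Lemma mx_of_rows1 n :
  mx_of_rows n [seq [seq (i == j)%:R | j <- iota 0 n] | i <- iota 0 n] = 1%:M.
Proof.
apply/matrixP => i j; rewrite !mxE (nth_map 0%N) ?size_iota //.
by rewrite (nth_map 0%N) ?size_iota // !nth_iota.
Qed.

(** The matrices W and B are unimodular, so an explicit integer inverse, checked by computation,
    maps to the inverse over any field. *)
Lemma invmx_map_int (F : fieldType) n (A B : 'M[int]_n) :
  A *m B = 1%:M -> invmx (map_mx intr A : 'M[F]_n) = map_mx intr B.
Proof.
move=> /(congr1 (map_mx (intr : int -> F))); rewrite map_mxM map_mx1 => AB.
by rewrite -[RHS](mulKmx (proj1 (mulmx1_unit AB))) AB mulmx1.
Qed.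

Lemma Wmx_inv : Wmx GammaP *m mx_of_rows 6
  [:: [:: -30; 6; 15; 10; 6; 6]; [:: 6; -1; -3; -2; -1; -1];
      [:: 15; -3; -7; -5; -3; -3]; [:: 10; -2; -5; -3; -2; -2];
      [:: 6; -1; -3; -2; -2; -1]; [:: 6; -1; -3; -2; -1; -2]] = 1%:M.
Proof. by rewrite -mx_of_rows1; apply: mx_of_rows_mul; vm_compute. Qed.

Definition Bmx_inv_rows : seq (seq int) :=
  [:: [:: -30; 15; 10; 6]; [:: 15; -7; -5; -3];
      [:: 10; -5; -3; -2]; [:: 6; -3; -2; -1]].

Lemma Bmx_inv : Bmx *m mx_of_rows 4 Bmx_inv_rows = 1%:M.
Proof. by rewrite -mx_of_rows1; apply: mx_of_rows_mul; vm_compute. Qed.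

Section Admissible.
Variable R : realType.

Lemma SmxE :
  Smx GammaP R = map_mx intr (mx_of_rows 2 [:: [:: 30; -6]; [:: -6; 1]]).
Proof.
rewrite /Smx /WmxR (invmx_map_int _ Wmx_inv).
by apply/matrixP => -[[|[|//]] ?] -[[|[|//]] ?]; rewrite !mxE /= -rmorphN.
Qed.

Lemma S_eigenvalue_counts :
  num_neg_eigen (Smx GammaP R) = 1%N /\ num_pos_eigen (Smx GammaP R) = 1%N.
Proof.
rewrite SmxE.
(* The characteristic polynomial x^2 - 31 x - 6 is positive at -1, negative at 0 and positive at
   32. *)
apply: (@eigenvalue_counts_half _ 2 _ (-2) [:: 0] [:: 64]).
by vm_compute.
Qed.

Lemma GammaP_admissible : hgraph_admissible GammaP R.
Proof.
split.
  right; apply: etrans (laplace_detE _ (fun i j => nth 0 (nth [::] _ i) j)) _.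
  by vm_compute.
by rewrite /indefinite; have [-> ->] := S_eigenvalue_counts.
Qed.

Lemma sigma_W0 : sigma_W GammaP R = 0.
Proof. by rewrite /sigma_W /signature; have [-> ->] := W_eigenvalue_counts R. Qed.

Lemma sigma'_W0 : sigma'_W GammaP R = 0.
Proof.
rewrite /sigma'_W sigma_W0 /sigma_S /signature.
by have [-> ->] := S_eigenvalue_counts.
Qed.

Lemma signature_B : signature (BmxR R) = 2.
Proof. by rewrite /signature; have [-> ->] := B_eigenvalue_counts R. Qed.

Lemma trace_B : \tr Bmx = 11.
Proof. by rewrite /mxtrace !big_ord_recl big_ord0 !mxE. Qed.

End Admissible.

(** Eliminating the leaves diagonalises B. The central vertex is left with the Schur complement 1 -
    1/2 - 1/3 - 1/5 = -1/30, whose inverse is the factor -30. *)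
Lemma BformE (l : 'cV[int]_4) :
  let v i := (l (inord i) 0)%:~R : rat in
  Bform l = v 1%N ^+ 2 / 2 + v 2%N ^+ 2 / 3 + v 3%N ^+ 2 / 5
            - 30 * (v 0%N - v 1%N / 2 - v 2%N / 3 - v 3%N / 5) ^+ 2.
Proof.
move=> v; rewrite /Bform (invmx_map_int _ Bmx_inv) !mxE.
do !rewrite !big_ord_recl !big_ord0 !mxE /=.
have inordE i (i0 : 'I_4) : i0 = i :> nat -> inord i = i0.
  by move=> <-; rewrite inord_val.
rewrite /v (inordE 0%N ord0) // (inordE 1%N (lift ord0 ord0)) //.
rewrite (inordE 2%N (lift ord0 (lift ord0 ord0))) //.
rewrite (inordE 3%N (lift ord0 (lift ord0 (lift ord0 ord0)))) //.
by field.
Qed.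

(** * Absolutely convergent sums *)

Section EsumFamilies.
Variable R : realType.
Local Open Scope ereal_scope.

Lemma esumZl (I : choiceType) (D : set I) (r : R) (f : I -> \bar R) :
  (0 <= r)%R -> (forall i, 0 <= f i) ->
  \esum_(i in D) (r%:E * f i) = r%:E * \esum_(i in D) f i.
Proof.
move=> r0 f0; rewrite /esum -ereal_supZl //; last first.
  apply/set0P; exists (\sum_(x \in set0) f x).
  by exists set0 => //; exact: fsets_set0.
rewrite image_comp; congr ereal_sup; apply: eq_imagel => X _ /=.
by rewrite ge0_mule_fsumr.
Qed.

(** Terms off the range of [h] vanish, and injectivity makes the range a copy of [A * J], over which
    the sum can be iterated. This is what cuts a series into finitely many progressions. *)
Lemma esum_family (A : finType) (I J : choiceType) (D : set I)
    (h : A -> J -> I) (g : I -> \bar R) :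
    (forall i, 0 <= g i) ->
    (forall a j, D (h a j)) ->
    (forall a j b k, h a j = h b k -> (a, j) = (b, k)) ->
    (forall i, D i -> (exists a j, i = h a j) \/ g i = 0) ->
  \esum_(i in D) g i = \sum_a \esum_(j in [set: J]) g (h a j).
Proof.
move=> g0 hD hinj supp; pose H (p : A * J) := h p.1 p.2.
rewrite (esumID (range H)) // [X in _ + X]esum1 ?adde0; last first.
  by move=> i [/supp[[a [j ->]] []|//]]; exists (a, j).
have -> : D `&` range H = range H.
  by apply/setIidPr => _ [[a j] _ <-]; exact: hD.
rewrite esum_image; last by move=> [a j] [b k] _ _ /hinj.
transitivity (\esum_(a in [set: A]) \esum_(j in [set: J]) g (h a j)).
  rewrite esum_esum //; congr esum.
  by apply/seteqP; split.
rewrite esum_fset //; last by move=> a _; exact: esum_ge0.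
rewrite (_ : [set: A] = [set` enum A]) -?fsbig_seq ?enum_uniq ?big_enum //.
- by apply/seteqP; split=> // a _ /=; rewrite mem_enum.
- exact: finite_finset.
Qed.

End EsumFamilies.

Section RealSums.
Variable R : realType.

Let rsummable (I : choiceType) (D : set I) (f : I -> R) :=
  summable D (fun i => (f i)%:E).
Let pos (I : choiceType) (f : I -> R) i : R := Num.max (f i) 0.
Let neg (I : choiceType) (f : I -> R) i : R := Num.max (- f i) 0.

Lemma le_summable (I : choiceType) (D : set I) (f g : I -> R) :
    (forall i, D i -> `|f i| <= `|g i|) ->
  summable D (EFin \o g) -> summable D (EFin \o f).
Proof. by move=> fg; apply: le_lt_trans; apply: le_esum => i /fg; rewrite lee_fin. Qed.

Lemma ge0_summable_fin_num (I : choiceType) (D : set I) (f : I -> R) :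
    (forall i, 0 <= f i) -> summable D (EFin \o f) ->
  (\esum_(i in D) (f i)%:E \is a fin_num)%E.
Proof.
move=> f0; rewrite summableE; congr (_ \is a fin_num).
by apply: eq_esum => i _ /=; rewrite ger0_norm.
Qed.

Let rsumE (I : choiceType) (D : set I) (f : I -> R) :
  rsum D f = fine (\esum_(i in D) (pos f i)%:E) - fine (\esum_(i in D) (neg f i)%:E).
Proof. by []. Qed.
Let pos_ge0 (I : choiceType) (f : I -> R) i : 0 <= pos f i.
Proof. by rewrite /pos le_max lexx orbT. Qed.
Let neg_ge0 (I : choiceType) (f : I -> R) i : 0 <= neg f i.
Proof. by rewrite /neg le_max lexx orbT. Qed.
Let posnegE (I : choiceType) (f : I -> R) i : f i = pos f i - neg f i.
Proof. by rewrite /pos /neg; case: (leP (f i) 0); case: (leP (- f i) 0); lra. Qed.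
Let pos_le (I : choiceType) (f : I -> R) i : `|pos f i| <= `|f i|.
Proof.
by rewrite ger0_norm // /pos; case: (leP (f i) 0) => // _; rewrite ler_norm.
Qed.
Let neg_le (I : choiceType) (f : I -> R) i : `|neg f i| <= `|f i|.
Proof.
by rewrite ger0_norm // /neg -normrN; case: (leP (- f i) 0) => // _; rewrite ler_norm.
Qed.

Let summable_pos (I : choiceType) (D : set I) (f : I -> R) :
  rsummable D f -> summable D (EFin \o pos f).
Proof. by apply: le_summable => i _; exact: pos_le. Qed.
Let summable_neg (I : choiceType) (D : set I) (f : I -> R) :
  rsummable D f -> summable D (EFin \o neg f).
Proof. by apply: le_summable => i _; exact: neg_le. Qed.

#[local] Hint Resolve pos_ge0 neg_ge0 summable_pos summable_neg : core.

(** Any decomposition into summable nonnegative parts computes [rsum], because pos f + h = g + neg f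
    pointwise. Additivity needs this freedom, since the positive part of a sum is not the sum of the
    positive parts. *)
Lemma rsum_diff (I : choiceType) (D : set I) (f g h : I -> R) :
    (forall i, 0 <= g i) -> (forall i, 0 <= h i) ->
    summable D (EFin \o g) -> summable D (EFin \o h) ->
    (forall i, f i = g i - h i) ->
  rsum D f = fine (\esum_(i in D) (g i)%:E) - fine (\esum_(i in D) (h i)%:E).
Proof.
move=> g0 h0 sg sh fE.
have fg i : pos f i <= g i by rewrite /pos ge_max g0 fE andbT gerBl.
have fh i : neg f i <= h i by rewrite /neg ge_max h0 fE andbT opprB gerBl.
have sp : summable D (EFin \o pos f).
  by apply: le_summable sg => i _; rewrite !ger0_norm.
have sn : summable D (EFin \o neg f).
  by apply: le_summable sh => i _; rewrite !ger0_norm.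
rewrite rsumE; apply/eqP; rewrite subr_eq addrAC eq_sym subr_eq.
rewrite -!fineD; last 4 first.
- exact: (ge0_summable_fin_num (f := pos f)).
- exact: ge0_summable_fin_num.
- exact: ge0_summable_fin_num.
- exact: (ge0_summable_fin_num (f := neg f)).
rewrite -!esumD; try by move=> i _; rewrite lee_fin.
apply/eqP; congr fine; apply: eq_esum => i _; rewrite -!EFinD.
by congr EFin; have := posnegE f i; have := fE i; rewrite /pos /neg; lra.
Qed.

Lemma summableDr (I : choiceType) (D : set I) (f g : I -> R) :
  rsummable D f -> rsummable D g -> rsummable D (fun i => f i + g i).
Proof. by move=> sf sg; have := summableD sf sg. Qed.

Lemma summableZr (I : choiceType) (D : set I) (r : R) (f : I -> R) :
  rsummable D f -> rsummable D (fun i => r * f i).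
Proof.
rewrite /rsummable /summable => sf.
under eq_esum do rewrite EFinM abseM abse_EFin.
by rewrite esumZl // lte_mul_pinfty.
Qed.

Lemma rsumD (I : choiceType) (D : set I) (f g : I -> R) :
    rsummable D f -> rsummable D g ->
  rsum D (fun i => f i + g i) = rsum D f + rsum D g.
Proof.
move=> sf sg.
rewrite (@rsum_diff _ _ _ (fun i => pos f i + pos g i) (fun i => neg f i + neg g i)).
- under eq_esum do rewrite EFinD; under [in X in _ - X]eq_esum do rewrite EFinD.
  rewrite !esumD; try by move=> i _; rewrite lee_fin.
  rewrite !fineD; try by apply: ge0_summable_fin_num; auto.
  by rewrite !rsumE opprD addrACA.
- by move=> i; apply: addr_ge0 (pos_ge0 _ _) (pos_ge0 _ _).
- by move=> i; apply: addr_ge0 (neg_ge0 _ _) (neg_ge0 _ _).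
- exact: summableDr (summable_pos sf) (summable_pos sg).
- exact: summableDr (summable_neg sf) (summable_neg sg).
- by move=> i; rewrite (posnegE f) (posnegE g) opprD addrACA.
Qed.

Lemma rsumN (I : choiceType) (D : set I) (f : I -> R) :
  rsum D (fun i => - f i) = - rsum D f.
Proof.
rewrite /rsum opprB; congr (_ - _); congr fine.
by apply: eq_esum => i _; rewrite opprK.
Qed.

Lemma rsumZ (I : choiceType) (D : set I) (r : R) (f : I -> R) :
  rsum D (fun i => r * f i) = r * rsum D f.
Proof.
wlog r0 : r / 0 <= r => [H|].
  have [/H//|/ltW r0] := leP 0 r.
  rewrite -[r in RHS]opprK mulNr -H ?oppr_ge0 // -rsumN.
  by congr (rsum _ _); apply/funext => i; rewrite mulNr opprK.
have E (g : I -> R) : fine (\esum_(i in D) (Num.max (r * g i) 0)%:E) =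
    r * fine (\esum_(i in D) (Num.max (g i) 0)%:E).
  under eq_esum do rewrite -[in X in Num.max _ X](mulr0 r) -maxr_pMr // EFinM.
  rewrite esumZl //; last by move=> i; rewrite lee_fin; exact: pos_ge0.
  move: r0; rewrite le_eqVlt => /predU1P[<-|r0]; first by rewrite mul0e mul0r.
  (* No summability is assumed: [fine] sends an infinite sum to 0, and scaling by r > 0 keeps it
     infinite. *)
  case: (esum _ _) => [x||] //=; first by rewrite gt0_muley ?lte_fin //= mulr0.
  by rewrite gt0_muleNy ?lte_fin //= mulr0.
rewrite /rsum E mulrBr; congr (_ - _); rewrite -(E (fun i => - f i)).
by congr fine; apply: eq_esum => i _; rewrite mulrN.
Qed.

Lemma rsumID (I : choiceType) (B D : set I) (f : I -> R) :
  rsummable D f -> rsum D f = rsum (D `&` B) f + rsum (D `&` ~` B) f.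
Proof.
move=> sf.
have fin (g : I -> R) C : (forall i, 0 <= g i) -> summable D (EFin \o g) ->
    (\esum_(i in D `&` C) (g i)%:E \is a fin_num)%E.
  move=> g0 sg; apply: ge0_summable_fin_num => //; apply: le_lt_trans sg.
  by rewrite esum_mkcondr; apply: le_esum => i _; case: ifP.
rewrite !rsumE (esumID B); last by move=> i _; rewrite lee_fin; exact: pos_ge0.
rewrite [in X in _ - X](esumID B); last by move=> i _; rewrite lee_fin; exact: neg_ge0.
rewrite !fineD; try by [apply: (fin (pos f)) => //; auto |
                        apply: (fin (neg f)) => //; auto].
by rewrite opprD addrACA.
Qed.

Lemma rsum_family (A : finType) (I J : choiceType) (D : set I)
    (h : A -> J -> I) (f : I -> R) :
    (forall a j, D (h a j)) ->
    (forall a j b k, h a j = h b k -> (a, j) = (b, k)) ->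
    (forall i, D i -> (exists a j, i = h a j) \/ f i = 0) ->
    (forall a, rsummable [set: J] (f \o h a)) ->
  rsum D f = \sum_a rsum [set: J] (f \o h a).
Proof.
move=> hD hinj supp sf; rewrite rsumE.
rewrite (@esum_family _ A I J D h (EFin \o pos f)) //; last 2 first.
- by move=> i; rewrite lee_fin; exact: pos_ge0.
- by move=> i /supp[|fi0]; [left|right; rewrite /= /pos fi0 maxxx].
rewrite (@esum_family _ A I J D h (EFin \o neg f)) //; last 2 first.
- by move=> i; rewrite lee_fin; exact: neg_ge0.
- by move=> i /supp[|fi0]; [left|right; rewrite /= /neg fi0 oppr0 maxxx].
rewrite -!sum_fine ?sumrB // => a _.
- exact: ge0_summable_fin_num (neg_ge0 _) (summable_neg (sf a)).
- exact: ge0_summable_fin_num (pos_ge0 _) (summable_pos (sf a)).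
Qed.

End RealSums.

Section ComplexSums.
Variable R : realType.

Lemma ler_Re_normc (z : R[i]) : `|complex.Re z| <= Normc.normc z.
Proof.
by case: z => a b /=; rewrite -sqrtr_sqr ler_wsqrtr // lerDl sqr_ge0.
Qed.

Lemma ler_Im_normc (z : R[i]) : `|complex.Im z| <= Normc.normc z.
Proof.
by case: z => a b /=; rewrite -sqrtr_sqr ler_wsqrtr // lerDr sqr_ge0.
Qed.

Lemma normc_ge0 (z : R[i]) : 0 <= Normc.normc z.
Proof. by case: z => a b; exact: sqrtr_ge0. Qed.

Lemma csummable_Re (I : choiceType) (D : set I) (f : I -> R[i]) :
  csummable D f -> summable D (fun i => (complex.Re (f i))%:E).
Proof.
apply: le_summable => i _; rewrite (ger0_norm (normc_ge0 _)).
exact: ler_Re_normc.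
Qed.

Lemma csummable_Im (I : choiceType) (D : set I) (f : I -> R[i]) :
  csummable D f -> summable D (fun i => (complex.Im (f i))%:E).
Proof.
apply: le_summable => i _; rewrite (ger0_norm (normc_ge0 _)).
exact: ler_Im_normc.
Qed.

Lemma csummableZ (I : choiceType) (D : set I) (c : R[i]) (f : I -> R[i]) :
  csummable D f -> csummable D (fun i => c * f i).
Proof.
rewrite /csummable => sf; under eq_fun do rewrite Normc.normcM.
exact: summableZr.
Qed.

Lemma csumZ (I : choiceType) (D : set I) (c : R[i]) (f : I -> R[i]) :
  csummable D f -> csum D (fun i => c * f i) = c * csum D f.
Proof.
move=> /[dup] /csummable_Re sr /csummable_Im si; case: c => a b.
rewrite /csum.
have -> : (fun i => complex.Re ((a +i* b) * f i)) =
    (fun i => a * complex.Re (f i) + (- b) * complex.Im (f i)).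
  by apply/funext => i; case: (f i) => x y /=; rewrite mulNr.
have -> : (fun i => complex.Im ((a +i* b) * f i)) =
    (fun i => a * complex.Im (f i) + b * complex.Re (f i)).
  by apply/funext => i; case: (f i) => x y /=; rewrite [b * _]mulrC addrC mulrC.
rewrite !rsumD ?rsumZ; try exact: summableZr.
by rewrite mulNr /=.
Qed.

Lemma eq_csum (I : choiceType) (D : set I) (f g : I -> R[i]) :
  (forall i, D i -> f i = g i) -> csum D f = csum D g.
Proof.
move=> fg; rewrite /csum /rsum.
by congr ((fine _ - fine _) +i* (fine _ - fine _)); apply: eq_esum => i /fg ->.
Qed.

Lemma csumID (I : choiceType) (B D : set I) (f : I -> R[i]) :
  csummable D f -> csum D f = csum (D `&` B) f + csum (D `&` ~` B) f.
Proof.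
move=> sf; rewrite /csum (rsumID B (csummable_Re sf)).
by rewrite (rsumID B (csummable_Im sf)).
Qed.

Lemma reindex_csum (I J : choiceType) (P : set J) (D : set I) (h : J -> I)
    (f : I -> R[i]) :
  set_bij P D h -> csum D f = csum P (f \o h).
Proof. by move=> hP; rewrite /csum /rsum !(@reindex_esum _ _ _ P D h _ hP). Qed.

Lemma csummable_family (A : finType) (I J : choiceType) (D : set I)
    (h : A -> J -> I) (f : I -> R[i]) :
    (forall a j, D (h a j)) ->
    (forall a j b k, h a j = h b k -> (a, j) = (b, k)) ->
    (forall i, D i -> (exists a j, i = h a j) \/ f i = 0) ->
    (forall a, csummable [set: J] (f \o h a)) ->
  csummable D f.
Proof.
move=> hD hinj supp sf; rewrite /csummable /summable (esum_family _ hD hinj).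
- by rewrite lte_sum_pinfty // => a _; exact: sf.
- by [].
- by move=> i /supp[|->]; [left|right; rewrite Normc.normc0 abse0].
Qed.

Lemma csum_family (A : finType) (I J : choiceType) (D : set I)
    (h : A -> J -> I) (f : I -> R[i]) :
    (forall a j, D (h a j)) ->
    (forall a j b k, h a j = h b k -> (a, j) = (b, k)) ->
    (forall i, D i -> (exists a j, i = h a j) \/ f i = 0) ->
    (forall a, csummable [set: J] (f \o h a)) ->
  csum D f = \sum_a csum [set: J] (f \o h a).
Proof.
move=> hD hinj supp sf; rewrite /csum.
rewrite (rsum_family hD hinj); last 2 first.
- by move=> i /supp[|->]; [left|right].
- by move=> a; exact: csummable_Re (sf a).
rewrite (rsum_family hD hinj); last 2 first.
- by move=> i /supp[|->]; [left|right].
- by move=> a; exact: csummable_Im (sf a).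
by apply: (big_rec3 (fun x y z => x +i* y = z)) => // a x y z _ <-.
Qed.

(** One step of the telescoping in the second index: the terms with index 0 are peeled off and the
    others shifted down. *)
Lemma csum_split_snd (f : nat * nat -> R[i]) :
    csummable [set: nat * nat] f ->
  csum [set: nat * nat] f =
  csum [set: nat] (fun m => f (m, 0%N)) +
  csum [set: nat * nat] (fun p => f (p.1, p.2.+1)).
Proof.
move=> sf; rewrite (csumID [set p | p.2 = 0%N] sf) !setTI; congr (_ + _).
  rewrite (@reindex_csum _ _ [set: nat] _ (fun m => (m, 0%N))) //; split=> //.
    by move=> m n _ _ [].
  by move=> [m n] /= ->; exists m.
rewrite (@reindex_csum _ _ [set: nat * nat] _ (fun p => (p.1, p.2.+1))) //; split.
- by move=> [m n] _.
- by move=> [m n] [m' n'] _ _ [-> ->].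
- by move=> [m [|n]] //= _; exists (m, n).
Qed.

End ComplexSums.

(** * Geometric majorants *)

Section Geometric.
Variable R : realType.

Lemma esum_geometric (z : R) : 0 <= z -> z < 1 ->
  (\esum_(n in [set: nat]) (z ^+ n)%:E < +oo)%E.
Proof.
move=> z0 z1; rewrite -nneseries_esumT; last by move=> n; rewrite lee_fin exprn_ge0.
(* Every partial sum is at most 1 / (1 - z). *)
apply: le_lt_trans (ltry (1 - z)^-1).
apply: lime_le; first by apply: is_cvg_nneseries => n _ _; rewrite lee_fin exprn_ge0.
apply: nearW => n /=; rewrite sumEFin lee_fin.
have z1' : 0 < 1 - z by rewrite subr_gt0.
rewrite -[leRHS]mul1r ler_pdivlMr // mulrC.
rewrite big_mkord -[1 - z]opprB mulNr -subrX1 opprB gerBl.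
by rewrite exprn_ge0.
Qed.

Lemma summable_geometric (z : R) : 0 <= z -> z < 1 ->
  summable [set: nat] (fun n => (z ^+ n)%:E).
Proof.
move=> z0 z1; rewrite /summable; under eq_esum do rewrite gee0_abs ?lee_fin ?exprn_ge0 //.
exact: esum_geometric.
Qed.

Lemma summable_geometric2 (z : R) : 0 <= z -> z < 1 ->
  summable [set: nat * nat] (fun p => (z ^+ (p.1 + p.2))%:E).
Proof.
move=> z0 z1; rewrite /summable.
under eq_esum do rewrite gee0_abs ?lee_fin ?exprn_ge0 //.
rewrite -[X in esum X](_ : [set: nat] `*`` (fun=> [set: nat]) = _); last first.
  by apply/seteqP; split.
rewrite -(@esum_esum _ _ _ _ _ (fun m n => (z ^+ (m + n))%:E)); last first.
  by move=> m n _ _; rewrite lee_fin exprn_ge0.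
have [C CE] : exists C : R, \esum_(n in [set: nat]) (z ^+ n)%:E = C%:E.
  have := esum_geometric z0 z1.
  have : (0 <= \esum_(n in [set: nat]) (z ^+ n)%:E)%E.
    by apply: esum_ge0 => n _; rewrite lee_fin exprn_ge0.
  by case: (esum _ _) => // C _ _; exists C.
have C0 : 0 <= C.
  by rewrite -lee_fin -CE; apply: esum_ge0 => n _; rewrite lee_fin exprn_ge0.
rewrite (@eq_esum _ _ _ _ (fun m => C%:E * (z ^+ m)%:E)%E); last first.
  move=> m _; under eq_esum do rewrite exprD EFinM.
  rewrite esumZl ?exprn_ge0 ?CE 1?muleC // => n.
  by rewrite lee_fin exprn_ge0.
rewrite esumZl //; last by move=> j; rewrite lee_fin exprn_ge0.
by rewrite CE ltry.
Qed.

End Geometric.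

(** * The series of chi60 *)

Section Powers.
Variables (R : realType) (tau : R[i]).

Lemma eeD (x y : R[i]) : ee (x + y) = ee x * ee y.
Proof.
case: x y => a b [c d]; rewrite /ee /=.
rewrite !mulrDr opprD expRD cosD sinD.
by apply/eqP; rewrite eq_complex /=; apply/andP; split; apply/eqP; ring.
Qed.

Lemma qpowD (r s : rat) : qpow tau (r + s) = qpow tau r * qpow tau s.
Proof. by rewrite /qpow rmorphD /= rmorphD /= mulrDl eeD. Qed.

Lemma normc_ee (z : R[i]) : Normc.normc (ee z) = expR (- (2 * pi * complex.Im z)).
Proof.
rewrite /ee Normc.normcM /= cos2Dsin2 sqrtr1 mulr1 expr0n /= addr0 sqrtr_sqr.
by rewrite ger0_norm // expR_ge0.
Qed.

Hypothesis q_lt1 : `|ee tau| < 1.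

Lemma normc_ee_lt1 : Normc.normc (ee tau) < 1.
Proof. by have := q_lt1; rewrite /Num.norm /= -ltcR. Qed.

(** Comparison with a geometric family: the norm of q^r is |q|^r, and r >= w - C bounds it by
    |q|^(-C) |q|^w. *)
Lemma csummable_qpow (I : choiceType) (D : set I) (w : I -> nat) (C : nat)
    (r : I -> rat) :
    (forall i, D i -> (w i)%:R - C%:R <= r i) ->
    (forall z : R, 0 <= z -> z < 1 -> summable D (fun i => (z ^+ w i)%:E)) ->
  csummable D (fun i => qpow tau (r i)).
Proof.
move=> wr sw; set z := Normc.normc (ee tau).
have zE : z = expR (- (2 * pi * complex.Im tau)) by exact: normc_ee.
have := summableZr (expR ((2 * pi * complex.Im tau) * C%:R))
  (sw z (normc_ge0 _) normc_ee_lt1).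
apply: le_summable => i Di.
rewrite !ger0_norm ?normc_ge0 ?mulr_ge0 ?exprn_ge0 ?expR_ge0 ?normc_ge0 //.
rewrite /qpow normc_ee zE -expRM_natl -expRD ler_expR.
(* |q| < 1 means Im tau > 0, so norms decrease as exponents grow. *)
have t0 : 0 < 2 * pi * complex.Im tau.
  by have := normc_ee_lt1; rewrite -/z zE expR_lt1 oppr_lt0.
have /= : ratr ((w i)%:R - C%:R) <= ratr (r i) :> R by rewrite ler_rat wr.
rewrite rmorphB /= !ratr_nat.
have -> : complex.Im ((ratr (r i))%:C * tau) = ratr (r i) * complex.Im tau.
  by case: (tau) => a b /=; rewrite mul0r addr0.
rewrite -(ler_pM2l t0) => h.
lra.
Qed.

Lemma csummable_qpow_nat (C : nat) (r : nat -> rat) :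
    (forall n, n%:R - C%:R <= r n) ->
  csummable [set: nat] (fun n => qpow tau (r n)).
Proof.
move=> rn; apply: (@csummable_qpow _ _ id C) => [n _|z z0 z1]; first exact: rn.
exact: summable_geometric.
Qed.

Lemma csummable_qpow_nat2 (C : nat) (r : nat * nat -> rat) :
    (forall p, (p.1 + p.2)%:R - C%:R <= r p) ->
  csummable [set: nat * nat] (fun p => qpow tau (r p)).
Proof.
move=> rn; apply: (@csummable_qpow _ _ (fun p => p.1 + p.2)%N C) => [p _|z z0 z1].
  exact: rn.
exact: summable_geometric2.
Qed.

End Powers.

(** [shift_weight] collects all sign pairs giving the same shift, so coincidences are harmless and
    the sum may run over sign pairs. For weights -1, -1 the shift 1/2 does occur twice. *)
Lemma sum_shifts (R : realType) (u v : int) (F : rat -> R[i]) :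
  \sum_(x <- shifts u v) (shift_weight u v x)%:~R * F x =
  \sum_(e <- signs) \sum_(f <- signs) (e * f)%:~R * F (Defs.shift u v e f).
Proof.
transitivity (\sum_(x <- shifts u v) \sum_(e <- signs) \sum_(f <- signs)
    if x == Defs.shift u v e f then (e * f)%:~R * F x else 0).
  apply: eq_bigr => x _; rewrite /shift_weight rmorph_sum mulr_suml.
  apply: eq_bigr => e _; rewrite rmorph_sum mulr_suml big_mkcond.
  by apply: eq_bigr => f _; case: ifP => //; rewrite mul0r.
rewrite exchange_big; apply: eq_big_seq => e es.
rewrite exchange_big; apply: eq_big_seq => f fs.
rewrite (bigD1_seq (Defs.shift u v e f)) ?undup_uniq //=; last first.
  by rewrite mem_undup; apply/allpairsP; exists (e, f).
by rewrite eqxx big1 ?addr0 // => x /negPf ->.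
Qed.

(** * Residue classes modulo 60 *)

Definition sign3 := (bool * bool * bool)%type.
(** [true] stands for -1; booleans make the sign triples a finite type to sum over. *)
Definition sign_of (b : bool) : int := (-1) ^+ b.
Definition chi60_sign (a : sign3) : int :=
  sign_of a.1.1 * sign_of a.1.2 * sign_of a.2.
Definition chi60_base (a : sign3) : int :=
  30 - 15 * sign_of a.1.1 - 10 * sign_of a.1.2 - 6 * sign_of a.2.
Definition progression (a : sign3) (m : nat) : int := 60 * m%:Z + chi60_base a.

(** The bases -1, 11, 19, 31, 29, 41, 49, 61 are pairwise distinct modulo 60. *)
Lemma progression_inj a m b n : progression a m = progression b n -> (a, m) = (b, n).
Proof.
move: a b => [[[] []] []] [[[] []] []]; rewrite /progression /chi60_base /sign_of /= => H;
  by [have -> : m = n by lia | exfalso; lia].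
Qed.

Lemma progression_domain a m : -1 <= progression a m /\ progression a m <> 1.
Proof.
by move: a => [[[] []] []]; rewrite /progression /chi60_base /sign_of /=; split; lia.
Qed.

(** The bounds force k >= 0, so the absolute value is k itself. For a base of at most 49, k = -1
    already falls below -1; for the base 61 it gives the excluded n = 1. *)
Lemma progression_cover a (n k : int) :
  n = 60 * k + chi60_base a -> -1 <= n -> n <> 1 -> n = progression a `|k|%N.
Proof.
by move: a => [[[] []] []]; rewrite /progression /chi60_base /sign_of /= => ->; lia.
Qed.

Definition residue_base (e : int * int * int) : int :=
  30 - 15 * e.1.1 - 10 * e.1.2 - 6 * e.2.

(** Multiplying by 30 turns the congruence modulo 2 into one modulo 60. *)
Lemma chi60_residueE (e : int * int * int) (n : int) :
  chi60_residue e n = (60 %| n - residue_base e)%Z.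
Proof.
have xE : (n%:~R / 30 - (1 - e.1.1%:~R / 2 - e.1.2%:~R / 3 - e.2%:~R / 5)) / 2
    = (n - residue_base e)%:~R / 60 :> rat.
  by rewrite /residue_base !(rmorphB, rmorphM) /=; field.
rewrite /chi60_residue xE; apply/idP/idP => [/intrP[k kE]|/dvdzP[k ->]].
  apply/dvdzP; exists k; apply: (@intr_inj rat).
  by rewrite rmorphM /= -kE; field.
by rewrite rmorphM /= mulfK.
Qed.

Lemma chi60_progression a m : chi60 (progression a m) = chi60_sign a.
Proof.
(* The multiple of 60 drops out of the test, leaving eight closed computations. *)
rewrite /chi60 (@eq_filter _ _ (fun e => 60 %| chi60_base a - residue_base e)%Z).
  by move: a => [[[] []] []]; vm_compute.
by move=> e; rewrite chi60_residueE /progression -addrA rpredDl ?dvdz_mulr.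
Qed.

Lemma chi60_support n :
  -1 <= n -> n <> 1 -> (exists a m, n = progression a m) \/ chi60 n = 0.
Proof.
move=> n_ge n_neq1; rewrite /chi60.
set s := [seq (e12, e3) | e12 <- _, e3 <- _].
case E: [seq e <- s | _] => [|e s']; [by right | left].
have : e \in [seq e <- s | chi60_residue e n] by rewrite E mem_head.
rewrite mem_filter chi60_residueE => /andP[/dvdzP[k nk]].
have {}nk : n = 60 * k + residue_base e by rewrite mulrC -nk subrK.
rewrite /s /= !inE => es.
have [a ea] : exists a, residue_base e = chi60_base a.
  move: es; do !case/orP; move=> /eqP->.
  - by exists (false, false, false).
  - by exists (false, false, true).
  - by exists (false, true, false).
  - by exists (false, true, true).
  - by exists (true, false, false).
  - by exists (true, false, true).
  - by exists (true, true, false).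
  - by exists (true, true, true).
by exists a, `|k|%N; apply: progression_cover; rewrite // nk ea.
Qed.

Section Theta.
Variables (R : realType) (tau : R[i]).
Hypothesis q_lt1 : `|ee tau| < 1.

Definition partial_theta_term (r : int) (m : nat) : R[i] :=
  qpow tau (((60 * m%:Z + r) ^+ 2 - 1)%:~R / 120).

Definition partial_theta (r : int) : R[i] :=
  csum [set: nat] (partial_theta_term r).

Lemma csummable_partial_theta (r : int) : -1 <= r ->
  csummable [set: nat] (partial_theta_term r).
Proof.
move=> r1; apply: (csummable_qpow_nat q_lt1 (C := 1)) => n.
rewrite ler_pdivlMr // -[1%:R]/(1%:~R) -[n%:R]/(n%:~R) -rmorphB.
rewrite -[120]/(120%:~R) -rmorphM ler_int.
nia.
Qed.

Definition chi60_theta : R[i] :=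
  \sum_a (chi60_sign a)%:~R * partial_theta (chi60_base a).

Lemma chi60_base_ge (a : sign3) : -1 <= chi60_base a.
Proof. by move: a => [[[] []] []]. Qed.

Let I60 := [set n : int | -1 <= n /\ n != 1].

Lemma chi60_term_progression a :
  chi60_term tau \o progression a =
  (fun m => (chi60_sign a)%:~R * partial_theta_term (chi60_base a) m).
Proof. by apply/funext => m; rewrite /= /chi60_term chi60_progression. Qed.

Lemma csummable_chi60_progression a :
  csummable [set: nat] (chi60_term tau \o progression a).
Proof.
rewrite chi60_term_progression.
exact/csummableZ/csummable_partial_theta/chi60_base_ge.
Qed.

Let I60_progression a m : I60 (progression a m).
Proof. by have [? /eqP] := progression_domain a m. Qed.

Let I60_support n :
  I60 n -> (exists a m, n = progression a m) \/ chi60_term tau n = 0.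
Proof.
move=> [n_ge /eqP n1]; case: (chi60_support n_ge n1) => [|c0]; first by left.
by right; rewrite /chi60_term c0 mul0r.
Qed.

Lemma csummable_chi60 : csummable I60 (chi60_term tau).
Proof.
exact: csummable_family I60_progression progression_inj I60_support
  csummable_chi60_progression.
Qed.

Lemma csum_chi60 : csum I60 (chi60_term tau) = chi60_theta.
Proof.
rewrite (csum_family I60_progression progression_inj I60_support
  csummable_chi60_progression).
apply: eq_bigr => a _; rewrite chi60_term_progression csumZ //.
exact/csummable_partial_theta/chi60_base_ge.
Qed.

End Theta.

(** * The homological block *)

Lemma sign_of_inj : injective sign_of.
Proof. by move=> [] []. Qed.

Section Block.
Variables (R : realType) (tau : R[i]).
Hypothesis q_lt1 : `|ee tau| < 1.

(* The sign a.1 of the central entry is factored out, so that the term only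
   depends on a.2 and m. *)
Definition block_vector (a : bool * sign3) (m : nat) : 'cV[int]_4 :=
  \col_i (sign_of a.1 * nth 0 [:: 1 + 2 * m%:Z; sign_of a.2.1.1;
                                   sign_of a.2.1.2; sign_of a.2.2] i).

Lemma block_vectorE a m k : (k < 4)%N ->
  block_vector a m (inord k) 0 =
  sign_of a.1 * nth 0 [:: 1 + 2 * m%:Z; sign_of a.2.1.1;
                          sign_of a.2.1.2; sign_of a.2.2] k.
Proof. by move=> k4; rewrite mxE inordK. Qed.

Lemma prod_leaves (l : 'cV[int]_4) :
  \prod_(i < 4 | i != 0) Fleaf R (l i 0) =
  Fleaf R (l (inord 1) 0) * Fleaf R (l (inord 2) 0) * Fleaf R (l (inord 3) 0).
Proof.
rewrite big_mkcond !big_ord_recl big_ord0 /= mul1r mulr1 mulrA.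
by congr (Fleaf _ (l _ _) * Fleaf _ (l _ _) * Fleaf _ (l _ _));
  apply/val_inj; rewrite /= inordK.
Qed.

Lemma block_vector_odd a m : odd_vectors (block_vector a m).
Proof.
move=> i; rewrite mxE.
have sodd b : exists k, sign_of b = 1 + 2 * k.
  by case: b; [exists (-1)|exists 0].
have modd (x y : int) : (exists k, x = 1 + 2 * k) -> (exists k, y = 1 + 2 * k) ->
    exists k, x * y = 1 + 2 * k.
  by move=> [k ->] [j ->]; exists (k + j + 2 * k * j); ring.
apply: modd (sodd _) _; case: i => [[|[|[|[|//]]]] ?] //=.
by exists m%:Z.
Qed.

Lemma block_vector_inj a m b n :
  block_vector a m = block_vector b n -> (a, m) = (b, n).
Proof.
move=> /matrixP ab.
have E k := ab (inord k) 0.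
have := E 0%N; have := E 1%N; have := E 2%N; have := E 3%N.
rewrite !block_vectorE //=.
move: a b {ab E} => [s [[e1 e2] e3]] [s' [[f1 f2] f3]] /= h3 h2 h1 h0.
(* Since 1 + 2m > 0, the central entry determines both its sign and m. *)
have [ss mn] : s = s' /\ m = n.
  by move: h0; rewrite /sign_of; case: s {h1 h2 h3}; case: s' => /= ?; split; lia.
rewrite {}ss in h1 h2 h3 *; rewrite mn.
have sI : injective (fun x : int => sign_of s' * x).
  by apply: mulfI; case: (s').
by rewrite (sign_of_inj (sI _ _ h1)) (sign_of_inj (sI _ _ h2)) (sign_of_inj (sI _ _ h3)).
Qed.

Lemma block_support l :
  odd_vectors l -> (exists a m, l = block_vector a m) \/ block_term tau l = 0.
Proof.
move=> lodd; have [k l0] := lodd (inord 0).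
have F0 k' : l (inord k') 0 \notin signs -> Fleaf R (l (inord k') 0) = 0.
  by rewrite /Fleaf !inE => /negPf ->.
have [l1|/F0 E] := boolP (l (inord 1) 0 \in signs); last first.
  by right; rewrite /block_term prod_leaves E !(mul0r, mulr0).
have [l2|/F0 E] := boolP (l (inord 2) 0 \in signs); last first.
  by right; rewrite /block_term prod_leaves E !(mul0r, mulr0).
have [l3|/F0 E] := boolP (l (inord 3) 0 \in signs); last first.
  by right; rewrite /block_term prod_leaves E !(mul0r, mulr0).
left; set s := l (inord 0) 0 < 0.
pose e i := sign_of s * l (inord i) 0 == -1.
(* If 1 + 2k is negative, it equals -(1 + 2m) with m = -k - 1. The leaf signs are taken relative to
   the central sign [s]. *)
exists (s, (e 1%N, e 2%N, e 3%N)), (absz (if s then - k - 1 else k)).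
have lE i : l (inord i) 0 \in signs -> l (inord i) 0 = sign_of s * sign_of (e i).
  by rewrite /e !inE => /orP[] /eqP ->; case: (s).
apply/matrixP => i j; rewrite ord1 -(inord_val i); move: (val i) (ltn_ord i) => {}i i4.
rewrite block_vectorE //=.
case: i i4 => [|[|[|[|//]]]] _ /=; try exact: lE.
by rewrite l0 /s l0 /sign_of; case: ltP => /=; lia.
Qed.

Lemma FcenterE b m : Fcenter R (sign_of b * (1 + 2 * m%:Z)) = (sign_of b)%:~R / 2.
Proof.
have H : (0 <= sign_of b * (1 + 2 * m%:Z)) = ~~ b by case: b; rewrite /sign_of /=; lia.
by rewrite /Fcenter /Defs.sgn H; case: b {H}.
Qed.

Lemma FleafE b c : Fleaf R (sign_of b * sign_of c) = - (sign_of b * sign_of c)%:~R.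
Proof. by case: b; case: c. Qed.

Lemma block_term_vector (a : bool * sign3) :
  block_term tau \o block_vector a =
  (fun m => - (chi60_sign a.2)%:~R / 2 * qpow tau (- 1 / 4) *
            partial_theta_term tau (chi60_base a.2) m).
Proof.
have s2 b : (sign_of b)%:~R * (sign_of b)%:~R = 1 :> R[i].
  by rewrite -intrM; case: b.
have s2q b : (sign_of b)%:~R * (sign_of b)%:~R = 1 :> rat by case: b.
apply/funext => m; rewrite /= /block_term prod_leaves.
have -> : block_vector a m 0 0 = block_vector a m (inord 0) 0.
  by congr (block_vector a m _ _); apply/val_inj; rewrite /= inordK.
rewrite !block_vectorE //=.
rewrite FcenterE !FleafE -mulrA -[RHS]mulrA -qpowD.
(* The leaf squares give -(1/2 + 1/3 + 1/5)/4 = -1/4 - 1/120, and the central square gives (60 m +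
   r)^2 / 120. The common sign [t] disappears on squaring. *)
have -> : - Bform (block_vector a m) / 4 =
    - 1 / 4 + ((60 * m%:Z + chi60_base a.2) ^+ 2 - 1)%:~R / 120.
  rewrite BformE !block_vectorE //= /chi60_base.
  move: (s2q a.1) (s2q a.2.1.1) (s2q a.2.1.2) (s2q a.2.2).
  move: (sign_of a.1) (sign_of a.2.1.1) (sign_of a.2.1.2) (sign_of a.2.2).
  move=> t e1 e2 e3 t1 h1 h2 h3.
  have sq x : (t%:~R * x) ^+ 2 = x ^+ 2 :> rat by rewrite exprMn [t%:~R ^+ 2]t1 mul1r.
  rewrite !(intrM, intrD, intrB, rmorphN, rmorphXn) /= !sq.
  have -> : t%:~R * (1%:~R + 2%:~R * m%:~R) - t%:~R * e1%:~R / 2 - t%:~R * e2%:~R / 3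
       - t%:~R * e3%:~R / 5 =
    t%:~R * (1 + 2 * m%:~R - e1%:~R / 2 - e2%:~R / 3 - e3%:~R / 5) :> rat by field.
  by rewrite sq [e1%:~R ^+ 2]h1 [e2%:~R ^+ 2]h2 [e3%:~R ^+ 2]h3; field.
rewrite mulrA; congr (_ * _).
rewrite /chi60_sign !rmorphM /=.
move: (s2 a.1); move: ((sign_of a.1)%:~R : R[i]) => t t1.
(* The common sign occurs four times, once per vertex, and cancels; the three leaves leave
   (-1)^3. *)
transitivity ((t * t) * (t * t) * - ((sign_of a.2.1.1)%:~R *
   (sign_of a.2.1.2)%:~R * (sign_of a.2.2)%:~R) / 2); first by ring.
by rewrite !t1 !mul1r.
Qed.

Lemma csummable_block_vector a : csummable [set: nat] (block_term tau \o block_vector a).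
Proof.
rewrite block_term_vector.
exact/csummableZ/(csummable_partial_theta q_lt1)/chi60_base_ge.
Qed.

Lemma csummable_block : csummable odd_vectors (block_term tau).
Proof.
exact: csummable_family block_vector_odd block_vector_inj block_support
  csummable_block_vector.
Qed.

Lemma csum_block :
  csum odd_vectors (block_term tau) = - qpow tau (- 1 / 4) * chi60_theta tau.
Proof.
rewrite (csum_family block_vector_odd block_vector_inj block_support
  csummable_block_vector).
pose c (a : sign3) := - (chi60_sign a)%:~R / 2 * qpow tau (- 1 / 4) *
  partial_theta tau (chi60_base a).
transitivity (\sum_(a : bool * sign3) c a.2).
  apply: eq_bigr => a _; rewrite block_term_vector csumZ //.
  exact/(csummable_partial_theta q_lt1)/chi60_base_ge.
rewrite -(pair_big predT predT (fun _ a => c a)) /= big_bool /= -big_split /=.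
rewrite /chi60_theta !mulr_sumr; apply: eq_bigr => a _; rewrite /c.
by field.
Qed.

Lemma homological_blockE :
  homological_block tau = qpow tau (- 3 / 2) * chi60_theta tau.
Proof.
rewrite /homological_block csum_block signature_B trace_B.
have [_ ->] := B_eigenvalue_counts R.
(* Signature 2 and trace 11 give -5/4, to which the block sum adds -1/4. Its minus sign cancels
   (-1)^3 from the three positive eigenvalues. *)
have -> : - 3 / 2 = (3 * 2 - 11)%:~R / 4 + - 1 / 4 :> rat by field.
by rewrite qpowD; ring.
Qed.

End Block.

(** * The indefinite false theta function *)

Section ZhatGammaP.
Variables (R : realType) (tau : R[i]).
Hypothesis q_lt1 : `|ee tau| < 1.

Lemma QprimeE (x y : rat) :
  Qprime GammaP x y = 30 * x ^+ 2 + 12 * x * y + y ^+ 2.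
Proof.
rewrite /Qprime (_ : hM GammaP * ha GammaP = - 30) //.
rewrite (_ : hM GammaP * hN GammaP = 6) // (_ : hN GammaP * hc GammaP = - 1) //.
by rewrite !normrN !ger0_norm //; field.
Qed.

Lemma theta_summable (x y : rat) : 0 <= x -> - 1 / 2 <= y ->
  csummable [set: nat * nat] (theta_term GammaP tau x y).
Proof.
move=> x0 y0; apply: (csummable_qpow_nat2 q_lt1 (C := 3)) => -[m n] /=.
rewrite QprimeE natrD.
have m0 : 0 <= m%:R :> rat by [].
have n0 : 0 <= n%:R :> rat by [].
set u := x + m%:R; set v := y + n%:R.
have um : m%:R <= u by rewrite /u; lra.
have vn : n%:R - 1 / 2 <= v by rewrite /v; lra.
(* As v >= -1/2, the cross term 12 u v is at least -6 u, which 30 u^2 absorbs up to a constant; the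
   two squares below supply linear lower bounds. *)
have uv : 0 <= u * (v + 1 / 2) by apply: mulr_ge0; lra.
have := sqr_ge0 (u - 1 / 5); have := sqr_ge0 (v - 1); rewrite !expr2.
nra.
Qed.

(** Raising y by 1 amounts to dropping the terms n = 0, so the difference of two such double sums is
    a single sum along an edge. *)
Lemma theta_split (x y : rat) : 0 <= x -> - 1 / 2 <= y ->
  csum [set: nat * nat] (theta_term GammaP tau x y) =
  csum [set: nat] (fun m => qpow tau (Qprime GammaP (x + m%:R) y)) +
  csum [set: nat * nat] (theta_term GammaP tau x (y + 1)).
Proof.
move=> x0 y0; rewrite (csum_split_snd (theta_summable x0 y0)); congr (_ + _).
  by apply: eq_csum => m _; rewrite /theta_term /= addr0.
by apply: eq_csum => -[m n] _; rewrite /theta_term /= -addrA -natr1 [n%:R + 1]addrC.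
Qed.

(** Q'(x, y) = 30 (x + y/5)^2 - y^2/5. At y = -e_3/2 the constant is -1/20 = -1/24 - 1/120, and 60
    (x + y/5) is 60 m plus the base. *)
Lemma edge_sum (a b c : bool) :
  csum [set: nat] (fun m => qpow tau (Qprime GammaP
    (Defs.shift 2 3 (- sign_of a) (- sign_of b) + m%:R) (- (sign_of c)%:~R / 2))) =
  qpow tau (- 1 / 24) * partial_theta tau (chi60_base (a, b, c)).
Proof.
rewrite -csumZ; last exact/(csummable_partial_theta q_lt1)/chi60_base_ge.
apply: eq_csum => m _; rewrite -qpowD; congr qpow.
rewrite QprimeE /Defs.shift /chi60_base /=.
have : (sign_of c)%:~R ^+ 2 = 1 :> rat by case: c.
move: (sign_of a) (sign_of b) (sign_of c) => e1 e2 e3 h3.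
apply/eqP; rewrite -subr_eq0; apply/eqP.
transitivity ((1 - e3%:~R ^+ 2) / 20 : rat); last by rewrite h3 subrr mul0r.
by field.
Qed.

Lemma sum_signs (F : int -> R[i]) : \sum_(e <- signs) F e = F 1 + F (-1).
Proof. by rewrite !big_cons big_nil addr0. Qed.

(** With T(y) the double sum, the combination T(-1/2) - 2 T(1/2) + T(3/2) is a difference of two
    first differences, that is, of the edge sums at y = -1/2 and y = 1/2. *)
Lemma theta_beta_sum (a b : bool) (x := Defs.shift 2 3 (- sign_of a) (- sign_of b)) :
  \sum_(e <- signs) \sum_(f <- signs) (e * f)%:~R *
    csum [set: nat * nat] (theta_term GammaP tau x (Defs.shift (-1) (-1) e f)) =
  qpow tau (- 1 / 24) * (partial_theta tau (chi60_base (a, b, false))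
                         - partial_theta tau (chi60_base (a, b, true))).
Proof.
rewrite !sum_signs.
have x0 : 0 <= x.
  by rewrite /x /Defs.shift {x} /sign_of; case: a; case: b => /=; lra.
rewrite (_ : Defs.shift (-1) (-1) 1 1 = - 1 / 2); last by rewrite /Defs.shift; field.
rewrite (_ : Defs.shift (-1) (-1) 1 (-1) = 1 / 2); last by rewrite /Defs.shift; field.
rewrite (_ : Defs.shift (-1) (-1) (-1) 1 = 1 / 2); last by rewrite /Defs.shift; field.
rewrite (_ : Defs.shift (-1) (-1) (-1) (-1) = 1 / 2 + 1); last first.
  by rewrite /Defs.shift; field.
rewrite [X in _ * X + _ + _](@theta_split x (- 1 / 2)) //.
have -> : - 1 / 2 + 1 = 1 / 2 :> rat by [].
rewrite !(@theta_split x (1 / 2)) //.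
have := edge_sum a b false; have := edge_sum a b true; rewrite -/x.
rewrite (_ : - (sign_of true)%:~R / 2 = 1 / 2) // => ->.
rewrite (_ : - (sign_of false)%:~R / 2 = - 1 / 2) // => ->.
by ring.
Qed.

Lemma chi60_thetaE : chi60_theta tau =
  \sum_(a : bool) \sum_(b : bool) (sign_of a * sign_of b)%:~R *
    (partial_theta tau (chi60_base (a, b, false))
     - partial_theta tau (chi60_base (a, b, true))).
Proof.
pose F a b c := (chi60_sign (a, b, c))%:~R * partial_theta tau (chi60_base (a, b, c)).
transitivity (\sum_(p : bool * bool) \sum_(c : bool) F p.1 p.2 c).
  by rewrite (pair_big predT predT (fun p c => F p.1 p.2 c)); apply: eq_bigr => -[[]].
rewrite -(pair_big predT predT (fun a b => \sum_(c : bool) F a b c)) /=.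
apply: eq_bigr => a _; apply: eq_bigr => b _; rewrite big_bool /F /chi60_sign /=.
by rewrite !rmorphM /sign_of /=; ring.
Qed.

Lemma Zhat_exponentE : Zhat_exponent GammaP R = - 35 / 24.
Proof. by rewrite /Zhat_exponent sigma_W0 /=; field. Qed.

Lemma ZhatE : Zhat GammaP tau = - (qpow tau (- 3 / 2) * chi60_theta tau).
Proof.
(* -35/24 is the prefactor of [Zhat] and -1/24 comes from the edge sums. *)
have -> : qpow tau (- 3 / 2) = qpow tau (- 35 / 24) * qpow tau (- 1 / 24).
  by rewrite -qpowD; congr (qpow tau); field.
rewrite /Zhat sigma'_W0 Zhat_exponentE mul0r.
have -> : ee 0 = 1 :> R[i].
  by rewrite /ee /= !mulr0 oppr0 expR0 cos0 sin0 mulr1.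
(* Here N = 1 and a = -5; this is the source of the overall minus sign. *)
rewrite (_ : sgn _ = -1) //.
under eq_bigr => x _ do under eq_bigr => y _ do rewrite -mulrA.
under eq_bigr => x _ do rewrite -mulr_sumr sum_shifts.
pose G x := \sum_(e <- signs) \sum_(f <- signs) (e * f)%:~R *
    csum [set: nat * nat] (theta_term GammaP tau x (Defs.shift (-1) (-1) e f)).
rewrite (sum_shifts 2 3 G) !sum_signs.
(* The beta sums are kept behind an opaque [D], so that the closing identity is polynomial in four
   unknowns. *)
have [D GE ->] : exists2 D : bool -> bool -> R[i],
    forall a b, G (Defs.shift 2 3 (- sign_of a) (- sign_of b)) =
                qpow tau (- 1 / 24) * D a b &
    chi60_theta tau = \sum_(a : bool) \sum_(b : bool) (sign_of a * sign_of b)%:~R * D a b.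
  exists (fun a b => partial_theta tau (chi60_base (a, b, false))
                     - partial_theta tau (chi60_base (a, b, true))).
    by move=> a b; exact: theta_beta_sum.
  exact: chi60_thetaE.
(* The alpha shifts carry the signs opposite to those of the bases; negating both leaves their
   product unchanged. *)
have := GE true true; have := GE true false.
have := GE false true; have := GE false false.
rewrite /sign_of /= !opprK => -> -> -> ->; rewrite !big_bool /=.
move: (D true true) (D true false) (D false true) (D false false).
move: (qpow tau _) (qpow tau _) => u v d1 d2 d3 d4.
by ring.
Qed.

End ZhatGammaP.

Theorem proposition8p2 (R : realType) (tau : R[i]) (q_lt1 : `|ee tau| < 1) :
  let I60 := [set n : int | -1 <= n /\ n != 1] in
  let eta := qpow tau (- 3 / 2) * csum I60 (chi60_term tau) in
  [/\ hgraph_admissible GammaP R,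
      [/\ {in hT GammaP & hU GammaP, forall alpha beta,
            csummable [set: nat * nat] (theta_term GammaP tau alpha beta)},
          csummable I60 (chi60_term tau) &
          csummable odd_vectors (block_term tau)],
      Zhat GammaP tau = - eta &
      eta = homological_block tau].
Proof.
move=> I60 eta.
have etaE : eta = qpow tau (- 3 / 2) * chi60_theta tau by rewrite /eta csum_chi60.
split.
- exact: GammaP_admissible.
- split; [|exact: csummable_chi60|exact: csummable_block].
  move=> x y; rewrite !mem_undup => /allpairsP[[e f] [es fs ->]].
  move=> /allpairsP[[e' f'] [es' fs' ->]].
  move: es fs es' fs'; rewrite /= !inE => es fs es' fs'.
  (* The smallest alpha is 1/2 - 1/4 - 1/6 = 1/12 and the smallest beta is -1/2. *)
  apply: theta_summable q_lt1 _ _ _ _; rewrite /Defs.shift.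
    by case/orP: es => /eqP ->; case/orP: fs => /eqP ->; lra.
  by case/orP: es' => /eqP ->; case/orP: fs' => /eqP ->; lra.
- by rewrite etaE ZhatE.
- by rewrite etaE homological_blockE.
Qed.
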